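(* For every real $r\ge 0$ there exists a finite set $\mathcal{S}_r$ of low-defect pairs such that: (1) each $(f,C)\in\mathcal{S}_r$ has degree at most $\lfloor r\rfloor$; and (2) for every $N\in B_r$ there exists some $(f,C)\in\mathcal{S}_r$ that efficiently $3$-represents $N$.
   Context: $\|n\|$ denotes the complexity of a positive integer $n$: the least number of $1$'s needed to write $n$ using $1$, addition, multiplication and parentheses. The defect is $\delta(n)=\|n\|-3\log_3 n$. A positive integer $n$ is a leader if it is the smallest positive integer with defect $\delta(n)$ (equivalently, either $3\nmid n$, or $3\mid n$ and $\delta(n)<\delta(n/3)$). For real $r\ge0$, $B_r$ is the set of leaders $n$ with $\delta(n)<r$. For polynomials $f_1$ in variables $x_1,\dots,x_{r_1}$ and $f_2$ in $x_1,\dots,x_{r_2}$, define $(f_1\otimes f_2)(x_1,\dots,x_{r_1+r_2})=f_1(x_1,\dots,x_{r_1})f_2(x_{r_1+1},\dots,x_{r_1+r_2})$ (so the variables are relabelled so as to be disjoint); relabelling/permuting variables is regarded as giving the same object. The set of low-defect pairs is the smallest subset $\mathscr{P}$ of $\mathbb{Z}[x_1,x_2,\dots]\times\mathbb{N}$ such that: (i) for every positive integer constant $k$ and every integer $C\ge\|k\|$, $(k,C)\in\mathscr{P}$; (ii) if $(f_1,C_1),(f_2,C_2)\in\mathscr{P}$ then $(f_1\otimes f_2,C_1+C_2)\in\mathscr{P}$; (iii) if $(f,C)\in\mathscr{P}$, $c$ is a positive integer and $D\ge\|c\|$, then $(f\otimes x_1+c,\,C+D)\in\mathscr{P}$ (i.e.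 if $f$ is in $x_1,\dots,x_{r}$ this is $f(x_1,\dots,x_r)x_{r+1}+c$). The polynomials arising are low-defect polynomials; a low-defect polynomial built this way uses variables $x_1,\dots,x_r$ and its degree is $r$, the number of variables; the degree of a pair $(f,C)$ is the degree of $f$. A low-defect pair $(f,C)$ of degree $r$ efficiently $3$-represents $N$ if there are nonnegative integers $n_1,\dots,n_r$ with $N=f(3^{n_1},\dots,3^{n_r})$ and $\|N\|=C+3(n_1+\dots+n_r)$. *)

(* Defs.v *)
From HB Require Import structures.
From mathcomp Require Import all_boot all_order all_algebra.
From mathcomp Require Import mpoly.
From mathcomp Require Import boolp classical_sets cardinality reals exp.

Set Implicit Arguments.
Unset Strict Implicit.
Unset Printing Implicit Defensive.

Import Order.TTheory GRing.Theory Num.Theory.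
Local Open Scope ring_scope.

Inductive arith_expr : Type :=
| AOne
| AAdd of arith_expr & arith_expr
| AMul of arith_expr & arith_expr.

Fixpoint arith_val (e : arith_expr) : nat :=
  match e with
  | AOne => 1
  | AAdd a b => arith_val a + arith_val b
  | AMul a b => arith_val a * arith_val b
  end%N.

Fixpoint arith_ones (e : arith_expr) : nat :=
  match e with
  | AOne => 1
  | AAdd a b | AMul a b => arith_ones a + arith_ones b
  end%N.

Definition writable (n k : nat) : Prop :=
  exists e : arith_expr, arith_val e = n /\ arith_ones e = k.

Lemma writable_ex (n : nat) : exists k, `[< writable n.+1 k >].
Proof.
elim: n => [|n [k /asboolP [e [ve _]]]].
  by exists 1%N; apply/asboolP; exists AOne.
exists (arith_ones (AAdd AOne e)); apply/asboolP.
by exists (AAdd AOne e); split => //=; rewrite ve.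
Qed.

(* Meaningful for [0 < n] only: no expression has value 0, and the value at 0
   is a placeholder. *)
Definition complexity (n : nat) : nat :=
  if n is m.+1 then ex_minn (writable_ex m) else 0%N.

Definition defect (R : realType) (n : nat) : R :=
  (complexity n)%:R - 3 * (ln n%:R / ln 3).

Definition leader (R : realType) (n : nat) : Prop :=
  (0 < n)%N /\
  forall m : nat, (0 < m)%N -> defect R m = defect R n -> (n <= m)%N.

Definition leaders_below (R : realType) (r : R) : set nat :=
  [set n | leader R n /\ defect R n < r].

Definition mtensor (r1 r2 : nat) (f1 : {mpoly int[r1]}) (f2 : {mpoly int[r2]}) :
    {mpoly int[r1 + r2]} :=
  (f1 \mPo [tuple 'X_(lshift r2 i) | i < r1]) *
  (f2 \mPo [tuple 'X_(rshift r1 j) | j < r2]).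

Inductive low_defect :
    forall r : nat, {mpoly int[r]} -> nat -> Prop :=
| LowDefectConst (k C : nat) :
    (0 < k)%N -> (complexity k <= C)%N ->
    low_defect (k%:Z%:MP_[0]) C
| LowDefectTensor (r1 r2 : nat) (f1 : {mpoly int[r1]}) (f2 : {mpoly int[r2]})
    (C1 C2 : nat) :
    low_defect f1 C1 -> low_defect f2 C2 ->
    low_defect (mtensor f1 f2) (C1 + C2)%N
| LowDefectAdd (r : nat) (f : {mpoly int[r]}) (C c D : nat) :
    low_defect f C -> (0 < c)%N -> (complexity c <= D)%N ->
    low_defect (mtensor f ('X_(ord0 : 'I_1)) + c%:Z%:MP) (C + D)%N.

(* The number of variables of [ldp_poly] is also its total degree: see
   [msize_low_defect] below ([msize] is the total degree plus one). *)
Record low_defect_pair : Type := LowDefectPair {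
  ldp_degree : nat;
  ldp_poly : {mpoly int[ldp_degree]};
  ldp_base : nat;
  ldp_low_defect : low_defect ldp_poly ldp_base
}.

Definition efficiently_3_represents (p : low_defect_pair) (N : nat) : Prop :=
  exists n : 'I_(ldp_degree p) -> nat,
    N%:Z = (ldp_poly p).@[fun i => 3 ^+ n i] /\
    complexity N = (ldp_base p + 3 * \sum_i n i)%N.

Lemma msize_rename (m n : nat) (g : 'I_m -> 'I_n) (f : {mpoly int[m]}) :
  (msize (f \mPo [tuple 'X_(g i) | i < m]) <= msize f)%N.
Proof.
rewrite comp_mpolyEX; apply: (leq_trans (mmeasure_sum _ _ _ _)).
rewrite [X in (_ <= X)%N]msizeE !big_seq; elim/big_ind2: _ => //.
  by move=> a b c d ab cd; rewrite geq_max !leq_max ab cd orbT.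
move=> u fu; apply: (leq_trans (mmeasureZ_le _ _ _)).
rewrite comp_mpolyX; under eq_bigr do rewrite tnth_mktuple.
rewrite mprodXnE msizeX mdeg_sum.
by under eq_bigr do rewrite mdegMn mdeg1 mul1n; rewrite -mdegE.
Qed.

Lemma size_mmap_diag (r : nat) (f : {mpoly int[r]}) :
  (size (mmap polyC (fun=> 'X) f) <= msize f)%N.
Proof.
rewrite /mmap; apply: (leq_trans (size_sum _ _ _)).
rewrite msizeE !big_seq; elim/big_ind2: _ => //.
  by move=> a b c d ab cd; rewrite geq_max !leq_max ab cd orbT.
move=> u fu; rewrite mul_polyC; apply: (leq_trans (size_scale_leq _ _)).
by rewrite /mmap1 prodrXr -mdegE size_polyXn.
Qed.

Lemma msize_low_defect (r : nat) (f : {mpoly int[r]}) (C : nat) :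
  low_defect f C -> msize f = r.+1.
Proof.
pose dg n (p : {mpoly int[n]}) := mmap polyC (fun=> 'X : {poly int}) p.
have dgr m n (g : 'I_m -> 'I_n) (p : {mpoly int[m]}) :
    dg n (p \mPo [tuple 'X_(g i) | i < m]) = dg m p.
  rewrite comp_mpolyEX [in RHS](mpolyE p) /dg !raddf_sum /=.
  apply: eq_bigr => u _; rewrite !mmapZ; congr (_ * _).
  rewrite comp_mpolyX rmorph_prod mmapX /mmap1 /=; apply: eq_bigr => i _.
  by rewrite rmorphXn /= tnth_mktuple mmapX mmap1U.
have dgt m n (p : {mpoly int[m]}) (q : {mpoly int[n]}) :
    dg _ (mtensor p q) = dg _ p * dg _ q.
  rewrite -(dgr _ _ (lshift n) p) -(dgr _ _ (@rshift m n) q).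
  by rewrite /mtensor /dg rmorphM.
have mst m n (p : {mpoly int[m]}) (q : {mpoly int[n]}) a b :
    (msize p <= a.+1)%N -> (msize q <= b.+1)%N ->
    (msize (mtensor p q) <= (a + b).+1)%N.
  move=> pa qb.
  have pa' := leq_trans (msize_rename (lshift n) p) pa.
  have qb' := leq_trans (msize_rename (@rshift m n) q) qb.
  rewrite /mtensor; set P := _ \mPo _ in pa' *; set Q := _ \mPo _ in qb' *.
  have [->|P0] := eqVneq P 0; first by rewrite mul0r mmeasure0.
  have [->|Q0] := eqVneq Q 0; first by rewrite mulr0 mmeasure0.
  rewrite msizeM//; have := leq_add pa' qb'.
  by rewrite addSn addnS; case: (_ + _)%N.
move=> fC; have [fr rf] : (msize f <= r.+1)%N /\ size (dg _ f) = r.+1.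
  elim: {r f C} fC => [k C k0 _|m n p q C D _ [mp sp] _ [mq sq]|
                       n p C c D _ [mp sp] c0 _].
  - by rewrite mmeasureC /dg mmapC size_polyC eqz_nat -lt0n k0.
  - split; first exact: mst.
    by rewrite dgt size_mul -?size_poly_gt0 ?sp ?sq// addnS.
  - split.
      apply: (leq_trans (mmeasureD_le _ _ _)).
      rewrite geq_max mmeasureC mst//=; last by rewrite msizeX mdeg1.
      by apply: leq_trans (leq_b1 _) _.
    rewrite /dg raddfD /= -/(dg _ _) dgt /dg mmapX mmap1U mmapC -/(dg _ _).
    by rewrite size_MXaddC -size_poly_eq0 sp /= addn1.
by apply/eqP; rewrite eqn_leq fr -rf size_mmap_diag.
Qed.

(* Main.v *)
(* Choose alpha < 1 with r <= (floor r + 1) alpha. By strong induction on k, the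
   N with defect < (k + 1) alpha are covered, up to efficient multiplication by
   powers of 3, by finitely many pairs of degree at most k; a leader N leaves no
   room for a power of 3.

   If N has no factorization uv with ||N|| = ||u|| + ||v||, write it as an
   optimal sum a + b with b minimal. Then b = 1 or ||b|| >= 3, and since
   3 log_3 (1 + b/a) is at most 3 log_3 2 < 2, and tends to 0 when b = 1, either
   N is bounded or defect a <= defect N - alpha with ||b|| bounded: a pair for a
   yields one for N with one more variable. For k = 0 only the bounded case
   occurs, so N is a power of 3 times boundedly many bounded factors.

   In general N splits either into two factors of defect >= alpha, whose
   degrees add up to at most k by induction, or into an irreducible and at most
   one factor of defect < alpha, or into three factors of defect < alpha. *)

Require Import Defs.
From HB Require Import structures.
From mathcomp Require Import all_boot all_order all_algebra.
From mathcomp Require Import mpoly.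
From mathcomp Require Import boolp classical_sets cardinality reals exp.
From mathcomp Require Import zify ring lra.

Set Implicit Arguments.
Unset Strict Implicit.
Unset Printing Implicit Defensive.

Import Order.TTheory GRing.Theory Num.Theory.
Local Open Scope ring_scope.

(** * Elementary bounds for the complexity *)

Lemma arith_val_gt0 (e : arith_expr) : (0 < arith_val e)%N.
Proof. by elim: e => //= a Ha b Hb; [rewrite addn_gt0 Ha | rewrite muln_gt0 Ha]. Qed.

Lemma complexity_writable (n : nat) : (0 < n)%N -> writable n (complexity n).
Proof. by case: n => // n _; rewrite /complexity; case: ex_minnP => k /asboolP. Qed.

Lemma complexity_min (e : arith_expr) :
  (complexity (arith_val e) <= arith_ones e)%N.
Proof.
have := arith_val_gt0 e; case E: (arith_val e) => [//|n] _.
rewrite /complexity; case: ex_minnP => k _; apply.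
by apply/asboolP; exists e.
Qed.

Lemma complexityD (m n : nat) : (0 < m)%N -> (0 < n)%N ->
  (complexity (m + n) <= complexity m + complexity n)%N.
Proof.
move=> /complexity_writable[e [<- <-]] /complexity_writable[f [<- <-]].
exact: (complexity_min (AAdd e f)).
Qed.

Lemma complexityM (m n : nat) : (0 < m)%N -> (0 < n)%N ->
  (complexity (m * n) <= complexity m + complexity n)%N.
Proof.
move=> /complexity_writable[e [<- <-]] /complexity_writable[f [<- <-]].
exact: (complexity_min (AMul e f)).
Qed.

Lemma complexity_gt0 (n : nat) : (0 < n)%N -> (0 < complexity n)%N.
Proof.
move=> /complexity_writable[e [_ <-]].
by elim: e => //= a Ha b Hb; rewrite addn_gt0 Ha.
Qed.

Lemma complexity1 : complexity 1 = 1%N.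
Proof.
by apply/eqP; rewrite eqn_leq (complexity_min AOne) complexity_gt0.
Qed.

Lemma complexity_mul_exp3 (l n : nat) : (0 < n)%N ->
  (complexity (3 ^ l * n) <= complexity n + 3 * l)%N.
Proof.
move=> n0; elim: l => [|l IH]; first by rewrite mul1n addn0.
have h0 : (0 < 3 ^ l * n)%N by rewrite muln_gt0 expn_gt0.
rewrite expnS -mulnA; apply: (leq_trans (complexityM (isT : 0 < 3)%N h0)).
have h3 : (complexity 3 <= 3)%N := complexity_min (AAdd AOne (AAdd AOne AOne)).
lia.
Qed.

(** The classical bound $3\log_3 n\le\|n\|$ in integer form, by induction on an expression: the
    bounds multiply under products, and a sum of two values that are at least 2 is at most their
    product. *)
Lemma cube_le_exp3_complexity (n : nat) : (n ^ 3 <= 3 ^ complexity n)%N.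
Proof.
case: (posnP n) => [->//|/complexity_writable[e [<- <-]]] {n}.
elim: e => [//|a Ha b Hb|a Ha b Hb] /=; last first.
  by rewrite expnMn expnD leq_mul.
wlog ba : a b Ha Hb / (arith_val b <= arith_val a)%N.
  by move=> W; case: (leqP (arith_val b) (arith_val a)) => [|/ltnW] ?;
    [|rewrite addnC [X in (3 ^ X)%N]addnC]; apply: W.
(* A summand $b=1$ is separate: $(a+1)^3\le 3a^3$ for $a\ge 3$, and $a=1,2$ are checked directly;
   for $a=2$, $8\le 3^k$ forces $k\ge 2$. *)
have := arith_val_gt0 b; rewrite leq_eqVlt => /orP[/eqP b1|b2].
  have oa : (1 <= arith_ones a)%N by elim: a {Ha Hb ba} => //=; lia.
  have ob : (1 <= arith_ones b)%N by elim: b {Ha Hb ba b1} => //=; lia.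
  rewrite expnD -b1; have : (3 ^ 1 <= 3 ^ arith_ones b)%N by rewrite leq_exp2l.
  have : (3 ^ 1 <= 3 ^ arith_ones a)%N by rewrite leq_exp2l.
  have [a3|] := leqP 3 (arith_val a); first by move: Ha; rewrite !expnS expn0; nia.
  have := arith_val_gt0 a; case E: (arith_val a) Ha => [|[|[|]]]//= Ha _ _ ? ?.
    by nia.
  suff : (3 ^ 2 <= 3 ^ arith_ones a)%N by nia.
  rewrite leq_exp2l //; move: Ha; case: (arith_ones a) oa => [|[|]]//.
apply: leq_trans (_ : (arith_val a * arith_val b) ^ 3 <= _)%N.
  by rewrite leq_exp2r //; nia.
by rewrite expnMn expnD leq_mul.
Qed.

(** By subadditivity, the operands at the root of an optimal expression are optimal themselves. *)
Lemma complexity_decomp (n : nat) : (1 < n)%N ->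
  exists a b : nat, [/\ (0 < a)%N, (0 < b)%N,
    complexity n = (complexity a + complexity b)%N &
    n = (a + b)%N \/ n = (a * b)%N].
Proof.
move=> n1; have n0 := ltnW n1.
have [[|a b|a b] [en ec]] := complexity_writable n0.
- by rewrite -en in n1.
- have [a0 b0] := (arith_val_gt0 a, arith_val_gt0 b).
  exists (arith_val a), (arith_val b); split=> //; last by left.
  have := complexityD a0 b0; move: ec en (complexity_min a) (complexity_min b).
  by move=> /= ec ->; lia.
- have [a0 b0] := (arith_val_gt0 a, arith_val_gt0 b).
  exists (arith_val a), (arith_val b); split=> //; last by right.
  have := complexityM a0 b0; move: ec en (complexity_min a) (complexity_min b).
  by move=> /= ec ->; lia.
Qed.

(** * Factorizations and sums attaining the complexity *)

(* Positivity of the factors excludes the placeholder [complexity 0 = 0]; a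
   factor 1 is excluded by the complexity equation. *)
Definition good_product (n u v : nat) : Prop :=
  [/\ (0 < u)%N, (0 < v)%N, n = (u * v)%N &
      complexity n = (complexity u + complexity v)%N].

Lemma good_productC (n u v : nat) : good_product n u v -> good_product n v u.
Proof. by case=> u0 v0 -> e; split=> //; [rewrite mulnC | rewrite e addnC]. Qed.

Lemma good_product_lt (n u v : nat) : good_product n u v -> (v < n)%N.
Proof.
case=> u0 v0 -> e; case: (leqP u 1) => [u1|]; last by nia.
have u_1 : u = 1%N by lia.
by move: e; rewrite u_1 mul1n complexity1; lia.
Qed.

(** Subadditivity gives $\|n\|\le\|uv_1\|+\|v_2\|\le\|u\|+\|v_1\|+\|v_2\|=\|n\|$, so equality holds
    throughout. *)
Lemma good_productA (n u v v1 v2 : nat) :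
  good_product n u v -> good_product v v1 v2 ->
  good_product (u * v1) u v1 /\ good_product n (u * v1) v2.
Proof.
case=> u0 v0 -> e [v10 v20 ev e'].
have w0 : (0 < u * v1)%N by rewrite muln_gt0 u0.
have := complexityM u0 v10; have := complexityM w0 v20.
move: e; rewrite ev mulnA => e h1 h2; move: e'; rewrite ev => e'.
by split; split=> //; lia.
Qed.

Definition mult_irreducible (n : nat) : Prop :=
  forall u v : nat, ~ good_product n u v.

(* A sum with least summand b: if b were 2, one unit could be moved to a. *)
Lemma mult_irreducible_sum (n : nat) : (1 < n)%N -> mult_irreducible n ->
  exists a b : nat, [/\ (0 < b <= a)%N, n = (a + b)%N,
    complexity n = (complexity a + complexity b)%N &
    b = 1%N \/ (3 <= complexity b)%N].
Proof.
move=> n1 irr.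
pose P b := `[< exists a, [/\ (0 < a)%N, (0 < b)%N, n = (a + b)%N &
  complexity n = (complexity a + complexity b)%N] >].
have exP : exists b, P b.
  have [a [b [a0 b0 e [en|en]]]] := complexity_decomp n1; last by case: (irr a b).
  by exists b; apply/asboolP; exists a.
case: (ex_minnP exP) => b /asboolP[a [a0 b0 en e]] bmin.
exists a, b; split=> //.
  rewrite b0 bmin //; apply/asboolP; exists b; split=> //; lia.
have [b1|b1] := eqVneq b 1%N; first by left.
right; have [b2|b2] := eqVneq b 2%N.
  have c2 := cube_le_exp3_complexity 2.
  have c2' : (2 <= complexity 2)%N by move: c2; case: (complexity 2) => [|[|]].
  have h1 := complexityD a0 (isT : (0 < 1)%N).
  have a10 : (0 < a + 1)%N by lia.
  have := complexityD a10 (isT : (0 < 1)%N).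
  have : P 1%N -> False by move/bmin; rewrite b2.
  rewrite complexity1 in h1 *; move: en e; rewrite b2 => en e np h2.
  case: np; apply/asboolP; exists (a + 1)%N; split=> //; first by lia.
  by move: h2; rewrite complexity1 -addnA -en; lia.
have b3 : (3 <= b)%N by lia.
have : (3 ^ 3 <= 3 ^ complexity b)%N.
  by apply: leq_trans (cube_le_exp3_complexity b); rewrite leq_exp2r.
by rewrite leq_exp2l.
Qed.

(** * The defect under optimal products and sums *)

Section Defect.

Variable R : realType.
Implicit Types (n u v a b : nat) (x alpha : R).

Lemma ln3_gt0 : 0 < ln 3 :> R.
Proof. by rewrite ln_gt0 // ltr1n. Qed.

Lemma defect_ge0 n : (0 < n)%N -> 0 <= defect R n.
Proof.
move=> n0; have := cube_le_exp3_complexity n.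
rewrite -(ler_nat R) !natrX => h.
have : ln ((n%:R : R) ^+ 3) <= ln (3 ^+ complexity n).
  by rewrite ler_ln // posrE exprn_gt0 // ltr0n.
rewrite !lnXn ?ltr0n // => {}h.
rewrite /defect subr_ge0 mulrA ler_pdivrMr ?ln3_gt0 //.
by rewrite [leLHS]mulr_natl [leRHS]mulr_natl.
Qed.

Lemma defect_product n u v :
  good_product n u v -> defect R n = defect R u + defect R v.
Proof.
case=> u0 v0 en e; rewrite /defect e en natrM lnM ?posrE ?ltr0n //.
by rewrite natrD; ring.
Qed.

(** Vanishing defect means $n^3=3^{\|n\|}$, so $n$ divides a power of 3. *)
Lemma defect_eq0 n : (0 < n)%N -> defect R n = 0 ->
  exists j, n = (3 ^ j)%N /\ complexity n = (3 * j)%N.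
Proof.
move=> n0 /eqP; rewrite subr_eq0 mulrA => /eqP e.
have l0 : ln 3 != 0 :> R by rewrite gt_eqF ?ln3_gt0.
have {e} : ln ((3 ^ complexity n)%:R : R) = ln (n ^ 3)%:R.
  rewrite !natrX !lnXn ?ltr0n // -[LHS]mulr_natl -[RHS]mulr_natl e.
  by rewrite mulfVK.
move/ln_inj; rewrite !posrE !ltr0n !expn_gt0 n0 => /(_ isT isT) /eqP.
rewrite eqr_nat => /eqP e.
have : (n %| 3 ^ complexity n)%N by rewrite e dvdn_exp.
move=> /(dvdn_pfactor _ _ (isT : prime 3))[j _ nj].
exists j; split=> //; move: e; rewrite nj -expnM mulnC => /eqP.
by rewrite eqn_exp2l // => /eqP <-; rewrite -nj.
Qed.

Lemma defect_mul_exp3 n m l : (0 < m)%N -> n = (3 ^ l * m)%N ->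
  complexity n = (complexity m + 3 * l)%N -> defect R n = defect R m.
Proof.
move=> m0 en e; rewrite /defect e en natrM natrX lnM ?posrE ?exprn_gt0 ?ltr0n //.
rewrite lnXn ?ltr0n // natrD natrM -[ln 3 *+ l]mulr_natl.
by field; rewrite gt_eqF ?ln3_gt0.
Qed.

Lemma mult_irreducible_bounded_or_sum alpha : alpha < 1 ->
  exists A : nat, forall n, (1 < n)%N -> mult_irreducible n ->
    (n <= A)%N \/
    exists a b, [/\ (0 < b <= a)%N, n = (a + b)%N,
      complexity n = (complexity a + complexity b)%N,
      defect R a + alpha <= defect R n &
      (complexity b)%:R <= defect R n + 2].
Proof.
move=> a1; have l0 := ln3_gt0.
have d0 : 0 < ln 3 * (1 - alpha) by rewrite mulr_gt0 // subr_gt0.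
(* Chosen for $b=1$: $3\log_3(1+1/a)\le 3/(a\ln 3)$ is at most $1-\alpha$ once $a\ge
   3/((1-\alpha)\ln 3)$, and $a=n-1$ is at least this bound when $n$ exceeds it. *)
exists (Num.bound (3 / (ln 3 * (1 - alpha)))) => n n1 irr.
have [a [b [/andP[b0 ba] en e hb]]] := mult_irreducible_sum n1 irr.
have a0 : (0 < a)%N by apply: leq_trans ba.
pose t : R := 3 * ((ln n%:R - ln a%:R) / ln 3).
have dE : defect R n = defect R a + (complexity b)%:R - t.
  by rewrite /defect e natrD /t; field; rewrite gt_eqF.
have da := defect_ge0 a0.
(* Since $b\le a$, $n\le 2a$; and $2^3\le 3^2$. *)
have t2 : t <= 2.
  have h1 : ln (n%:R : R) <= ln 2 + ln a%:R.
    rewrite -lnM ?posrE ?ltr0n // -natrM ler_ln ?posrE ?ltr0n ?muln_gt0 //.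
      by rewrite ler_nat en; lia.
    exact: ltnW.
  have h2 : ln (2 ^+ 3) <= ln (3 ^+ 2) :> R.
    by rewrite ler_ln ?posrE ?exprn_gt0 ?ltr0n // -!natrX ler_nat.
  rewrite !lnXn ?ltr0n // in h2.
  rewrite /t mulrA ler_pdivrMr //; move: h1 h2.
  by rewrite -[ln 2 *+ 3]mulr_natl -[ln 3 *+ 2]mulr_natl; lra.
have hc : (complexity b)%:R <= defect R n + 2 by rewrite dE; lra.
(* If $\|b\|\ge 3$, then $\|b\|-t\ge 1>\alpha$. *)
case: hb => [b1|b3]; last first.
  right; exists a, b; split=> //; first exact/andP.
  by rewrite dE; move: b3; rewrite -(ler_nat R); lra.
have [nA|An] := leqP n (Num.bound (3 / (ln 3 * (1 - alpha)))); first by left.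
right; exists a, b; split=> //; first exact/andP.
rewrite dE b1 complexity1.
suff : t <= 1 - alpha by lra.
have aR0 : 0 < a%:R :> R by rewrite ltr0n.
have : ln (n%:R : R) - ln a%:R <= a%:R^-1.
  rewrite -ln_div ?posrE ?ltr0n //; last exact: ltnW.
  have -> : n%:R / a%:R = 1 + a%:R^-1 :> R.
    by rewrite en b1 natrD mulrDl divff ?mul1r // gt_eqF.
  by apply: le_ln1Dx; rewrite (lt_trans _ (_ : 0 < _)) // ?ltrN10 // invr_gt0.
move=> h; rewrite /t mulrA ler_pdivrMr //.
apply: (le_trans (ler_wpM2l _ h)) => //.
rewrite ler_pdivrMr // mulrC -ler_pdivrMr ?(mulrC (1 - alpha)) //.
have /ltW/le_trans -> // : 3 / (ln 3 * (1 - alpha)) < (Num.bound (3 / (ln 3 * (1 - alpha))))%:R.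
  by apply: archi_boundP; rewrite divr_ge0 // ltW.
by rewrite ler_nat; lia.
Qed.

(** Only finitely many [u] compete. The gap [x] is the slice width in the induction that bounds
    numbers of defect below $\alpha<1$. *)
Lemma defect_gap A : exists2 x, 0 < x &
  forall u, (u <= A)%N -> 0 < defect R u -> x <= defect R u.
Proof.
elim: A => [|A [x x0 IH]].
  have [d0|d0] := ltP 0 (defect R 0).
    by exists (defect R 0) => // u; rewrite leqn0 => /eqP ->.
  by exists 1 => // u; rewrite leqn0 => /eqP ->; rewrite ltNge d0.
have [d0|d0] := ltP 0 (defect R A.+1).
  exists (Num.min x (defect R A.+1)); first by rewrite lt_min x0.
  move=> u; rewrite leq_eqVlt => /orP[/eqP ->|uA du]; first by rewrite ge_min lexx orbT.
  by rewrite ge_min IH.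
exists x => // u; rewrite leq_eqVlt => /orP[/eqP ->|uA du]; last exact: IH.
by rewrite ltNge d0.
Qed.

(** The least factor occurring in such a product is irreducible: a factor of it would also occur,
    and be smaller. *)
Lemma good_product_irreducible n : (1 < n)%N ->
  mult_irreducible n \/
  exists u v, good_product n u v /\ mult_irreducible u.
Proof.
move=> n1; pose P u := `[< exists v, good_product n u v >].
have [[u0 Pu0]|nP] := pselect (exists u, P u); last first.
  by left=> u v g; apply: nP; exists u; apply/asboolP; exists v.
right; case: (ex_minnP (ex_intro P u0 Pu0)) => u /asboolP[v g] umin.
exists u, v; split=> // u1 u2 g'.
have [_ h] := good_productA (good_productC g) (good_productC g').
have /umin h' : P u1.
  by apply/asboolP; exists (v * u2)%N; apply: good_productC.
by have := good_product_lt (good_productC g'); rewrite ltnNge h'.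
Qed.

(* With alpha < 1 only bounded irreducible factors occur, and those other than
   powers of 3 have defects bounded away from 0, so there are few of them. *)
Lemma defect_lt1_bounded alpha : alpha < 1 ->
  exists M : nat, forall n, (0 < n)%N -> defect R n < alpha ->
    exists l m, [/\ (0 < m <= M)%N, n = (3 ^ l * m)%N &
      complexity n = (complexity m + 3 * l)%N].
Proof.
move=> a1; have [A hA] := mult_irreducible_bounded_or_sum a1.
have irrA u : (1 < u)%N -> mult_irreducible u -> defect R u < alpha -> (u <= A)%N.
  move=> u1 irr ua; have [//|[a [b [/andP[b0 ba] _ _ h _]]]] := hA u u1 irr.
  have := defect_ge0 (leq_trans b0 ba); lra.
have [x x0 hx] := defect_gap A.
(* The range $[0,\alpha)$ is cut into slices of width [x]; splitting off a bounded factor of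
   positive defect lowers [j]. *)
suff H j : exists M : nat, forall n, (0 < n)%N -> defect R n < alpha ->
    defect R n < j%:R * x -> exists l m, [/\ (0 < m <= M)%N, n = (3 ^ l * m)%N &
      complexity n = (complexity m + 3 * l)%N].
  have [M hM] := H (Num.bound (alpha / x)); exists M => n n0 na.
  apply: hM => //; apply: (lt_trans na).
  rewrite -ltr_pdivrMr //; apply: archi_boundP.
  apply: divr_ge0; apply: ltW => //.
  exact: le_lt_trans (defect_ge0 n0) na.
elim: j => [|j [M hM]].
  by exists 0%N => n n0 _; rewrite mul0r ltNge defect_ge0.
(* [A] serves irreducible [n]; [A * M] serves a factor at most [A] times the bounded part of its
   cofactor. Factors of defect 0 do not lower [j], hence the inner induction on [n]. *)
exists (A + A * M)%N; elim/ltn_ind => n IH n0 na nx.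
have n1 : (1 < n)%N.
  rewrite ltn_neqAle n0 andbT; apply/eqP => n1; move: na.
  by rewrite -n1 /defect complexity1 ln1 mul0r mulr0 subr0 ltNge ltW.
have [irr|[u [v [g irr]]]] := good_product_irreducible n1.
  exists 0%N, n; split; rewrite ?mul1n ?addn0 //.
  by rewrite n0 (leq_trans (irrA _ n1 irr na)) // leq_addr.
have [u0 v0 en e] := g.
have [du dv] := (defect_ge0 u0, defect_ge0 v0).
have dE := defect_product g.
have u1 : (1 < u)%N by have := good_product_lt (good_productC g); have := good_product_lt g; nia.
have [du0|du0] := eqVneq (defect R u) 0.
  have [k [eu ek]] := defect_eq0 u0 du0.
  have [l [m [hm ev ec]]] := IH v (good_product_lt g) v0 ltac:(lra) ltac:(lra).
  exists (k + l)%N, m; split=> //; first by rewrite en eu ev expnD mulnA.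
  by rewrite e ek ec; lia.
have uA : (u <= A)%N by apply: irrA => //; lra.
have ux : x <= defect R u by apply: hx => //; rewrite lt_neqAle eq_sym du0.
have [l [m [/andP[m0 mM] ev ec]]] : exists l m, [/\ (0 < m <= M)%N, v = (3 ^ l * m)%N &
      complexity v = (complexity m + 3 * l)%N].
  by apply: hM => //; [lra | move: nx; rewrite -natr1; lra].
have um0 : (0 < u * m)%N by rewrite muln_gt0 u0.
exists l, (u * m)%N; split.
- by rewrite um0 (leq_trans (leq_mul uA mM)) // leq_addl.
- by rewrite en ev mulnCA.
(* Subadditivity for $um$ gives one inequality; building [n] as $3^l\cdot um$ gives the other. *)
- have h1 := complexityM u0 m0.
  suff : (complexity n <= complexity (u * m) + 3 * l)%N by lia.
  by rewrite en ev mulnCA complexity_mul_exp3.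
Qed.

(* Take n = u v with defect u < alpha and v minimal. If v = v1 v2, minimality
   gives defect (u v1) >= alpha, so defect v2 < alpha unless the second case
   holds; symmetrically for v1. *)
Lemma defect_product_cases alpha n :
  [\/ mult_irreducible n,
      exists u v, [/\ good_product n u v, alpha <= defect R u &
                      alpha <= defect R v],
      exists u v, [/\ good_product n u v, defect R u < alpha &
                      mult_irreducible v] |
      exists u v, [/\ good_product n u v, defect R u < alpha &
        exists v1 v2, [/\ good_product v v1 v2, defect R v1 < alpha &
                          defect R v2 < alpha]]].
Proof.
have [irr|/existsNP[u0 /existsNP[v0 /contrapT g0]]] := pselect (mult_irreducible n).
  by constructor 1.
have [two|one] := pselect (exists u v, [/\ good_product n u v,
  alpha <= defect R u & alpha <= defect R v]); first by constructor 2.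
have {}one u v : good_product n u v -> alpha <= defect R u -> defect R v < alpha.
  by move=> g ua; rewrite ltNge; apply/negP => va; apply: one; exists u, v.
pose P v := `[< exists u, good_product n u v /\ defect R u < alpha >].
have exP : exists v, P v.
  have [u0a|u0a] := ltP (defect R u0) alpha.
    by exists v0; apply/asboolP; exists u0.
  exists u0; apply/asboolP; exists v0; split; first exact: good_productC.
  exact: one g0 u0a.
case: (ex_minnP exP) => v /asboolP[u [g ua]] vmin.
have [irr|/existsNP[v1 /existsNP[v2 /contrapT g']]] := pselect (mult_irreducible v).
  by constructor 3; exists u, v.
have last w1 w2 : good_product v w1 w2 -> defect R w2 < alpha.
  move=> h; have [_ h'] := good_productA g h; apply: (one _ _ h').
  rewrite leNgt; apply/negP => small.
  have /vmin : P w2 by apply/asboolP; exists (u * w1)%N.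
  by rewrite leqNgt (good_product_lt h).
constructor 4; exists u, v; split=> //; exists v1, v2; split=> //.
  exact: last (good_productC g').
exact: last g'.
Qed.

End Defect.

(** * Low-defect pairs and representation up to powers of 3 *)

Definition represents_up_to_exp3 (p : low_defect_pair) (N : nat) : Prop :=
  exists l M : nat, [/\ (0 < M)%N, N = (3 ^ l * M)%N,
    complexity N = (complexity M + 3 * l)%N & efficiently_3_represents p M].

(** Indexed by the predecessor, as is [add_pair], so that the constant is positive without a
    hypothesis. *)
Definition const_pair (k : nat) : low_defect_pair :=
  LowDefectPair (LowDefectConst (ltn0Sn k) (leqnn (complexity k.+1))).

Definition tensor_pair (p q : low_defect_pair) : low_defect_pair :=
  LowDefectPair (LowDefectTensor (ldp_low_defect p) (ldp_low_defect q)).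

Definition add_pair (p : low_defect_pair) (c : nat) : low_defect_pair :=
  LowDefectPair
    (LowDefectAdd (ldp_low_defect p) (ltn0Sn c) (leqnn (complexity c.+1))).

Lemma meval_mtensor (r1 r2 : nat) (f1 : {mpoly int[r1]})
    (f2 : {mpoly int[r2]}) (v : 'I_(r1 + r2) -> int) :
  (mtensor f1 f2).@[v] =
  f1.@[fun i => v (lshift r2 i)] * f2.@[fun j => v (rshift r1 j)].
Proof.
rewrite /mtensor rmorphM /= !comp_mpoly_meval.
by congr (_ * _); apply: meval_eq => i; rewrite tnth_mktuple mevalXU.
Qed.

Definition join_ord (r1 r2 : nat) (n1 : 'I_r1 -> nat) (n2 : 'I_r2 -> nat)
    (i : 'I_(r1 + r2)) : nat :=
  match fintype.split i with inl j => n1 j | inr j => n2 j end.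

Lemma join_ordl r1 r2 (n1 : 'I_r1 -> nat) (n2 : 'I_r2 -> nat) j :
  join_ord n1 n2 (lshift r2 j) = n1 j.
Proof. by rewrite /join_ord (unsplitK (inl j)). Qed.

Lemma join_ordr r1 r2 (n1 : 'I_r1 -> nat) (n2 : 'I_r2 -> nat) j :
  join_ord n1 n2 (rshift r1 j) = n2 j.
Proof. by rewrite /join_ord (unsplitK (inr j)). Qed.

Lemma sum_join_ord r1 r2 (n1 : 'I_r1 -> nat) (n2 : 'I_r2 -> nat) :
  (\sum_i join_ord n1 n2 i = \sum_i n1 i + \sum_i n2 i)%N.
Proof.
rewrite big_split_ord /=; congr (_ + _)%N; apply: eq_bigr => i _.
  exact: join_ordl.
exact: join_ordr.
Qed.

Lemma represents_const (k : nat) : efficiently_3_represents (const_pair k) k.+1.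
Proof.
exists (fun=> 0%N); split; first by rewrite /= mevalC.
by rewrite /= big_ord0 muln0 addn0.
Qed.

Lemma represents_tensor (p q : low_defect_pair) (N u v : nat) :
  good_product N u v ->
  represents_up_to_exp3 p u -> represents_up_to_exp3 q v ->
  represents_up_to_exp3 (tensor_pair p q) N.
Proof.
move=> [u0 v0 en e] [l1 [M1 [M10 eu cu [n1 [em1 cm1]]]]].
move=> [l2 [M2 [M20 ev cv [n2 [em2 cm2]]]]].
have M0 : (0 < M1 * M2)%N by rewrite muln_gt0 M10.
have NE : N = (3 ^ (l1 + l2) * (M1 * M2))%N by rewrite en eu ev expnD mulnACA.
(* $\|N\|=\|M_1\|+\|M_2\|+3(l_1+l_2)\ge\|M_1M_2\|+3(l_1+l_2)\ge\|N\|$, so the product $M_1M_2$ is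
   optimal. *)
have h1 := complexityM M10 M20.
have h2 := complexity_mul_exp3 (l1 + l2) M0; rewrite -NE in h2.
have cM : complexity (M1 * M2) = (complexity M1 + complexity M2)%N by lia.
exists (l1 + l2)%N, (M1 * M2)%N; split=> //; first by lia.
exists (join_ord n1 n2); split; last by rewrite /= sum_join_ord cM cm1 cm2; lia.
rewrite /= meval_mtensor PoszM em1 em2.
by congr (_ * _); apply: meval_eq => i; rewrite ?join_ordl ?join_ordr.
Qed.

(** The exponent [l] left over for [a] becomes the exponent of the new variable, so [N] itself is
    represented. *)
Lemma represents_add (p : low_defect_pair) (N a c : nat) :
  N = (a + c.+1)%N -> complexity N = (complexity a + complexity c.+1)%N ->
  represents_up_to_exp3 p a -> represents_up_to_exp3 (add_pair p c) N.
Proof.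
move=> en e [l [M [M0 ea ca [n [em cm]]]]].
exists 0%N, N; rewrite mul1n addn0; split=> //; first by rewrite en addnS.
exists (join_ord n (fun _ : 'I_1 => l)); split; last first.
  rewrite [X in _ = (_ + 3 * X)%N]sum_join_ord big_ord1.
  rewrite -[ldp_base _]/(ldp_base p + complexity c.+1)%N e ca cm; lia.
rewrite /= rmorphD /= mevalC meval_mtensor mevalXU join_ordr.
rewrite en PoszD ea PoszM mulrC em; congr (_ * _ + _); last by rewrite -natz natrX.
by apply: meval_eq => i; rewrite join_ordl.
Qed.

(** * Sets covered by finitely many pairs of bounded degree *)

Definition coverable (k : nat) (P : nat -> Prop) : Prop :=
  exists S : set low_defect_pair,
    [/\ finite_set S, forall p, S p -> (ldp_degree p <= k)%N &
        forall N, P N -> exists2 p, S p & represents_up_to_exp3 p N].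

Lemma coverable_sub (k k' : nat) (P Q : nat -> Prop) :
  (k <= k')%N -> (forall N, Q N -> P N) -> coverable k P -> coverable k' Q.
Proof.
move=> kk QP [S [fS dS cS]]; exists S; split=> // [p /dS|N /QP /cS //].
by move/leq_trans; apply.
Qed.

Lemma coverableU (k : nat) (P Q : nat -> Prop) :
  coverable k P -> coverable k Q -> coverable k (fun N => P N \/ Q N).
Proof.
move=> [S [fS dS cS]] [T [fT dT cT]]; exists (S `|` T)%classic; split.
- by rewrite finite_setU.
- by move=> p [/dS|/dT].
- by move=> N [/cS|/cT] [p Sp pN]; exists p => //; [left|right].
Qed.

Lemma coverable_bigU (k m : nat) (P : nat -> nat -> Prop) :
  (forall i, (i < m)%N -> coverable k (P i)) ->
  coverable k (fun N => exists2 i, (i < m)%N & P i N).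
Proof.
elim: m => [|m IH] H.
  by exists set0; split=> // N [].
have c1 := IH (fun i im => H i (ltnW im)).
apply: coverable_sub (coverableU c1 (H m (ltnSn m))) => // N [i].
by rewrite ltnS leq_eqVlt => /orP[/eqP ->|im PiN]; [right|left; exists i].
Qed.

Lemma coverable_bounded (k B : nat) :
  coverable k (fun N => exists l m, [/\ (0 < m <= B)%N, N = (3 ^ l * m)%N &
    complexity N = (complexity m + 3 * l)%N]).
Proof.
exists (const_pair @` `I_B)%classic; split.
- exact/finite_image/finite_II.
- by move=> _ [i _ <-].
- move=> N [l [[|m] [/andP[// _ mB] eN cN]]].
  exists (const_pair m); first by exists m.
  by exists l, m.+1; split=> //; exact: represents_const.
Qed.

Lemma coverable_product (i j : nat) (P Q : nat -> Prop) :
  coverable i P -> coverable j Q ->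
  coverable (i + j) (fun N => exists u v, [/\ good_product N u v, P u & Q v]).
Proof.
move=> [S [fS dS cS]] [T [fT dT cT]].
exists [set tensor_pair p q | p in S & q in T]%classic; split.
- exact: finite_image2.
- by move=> _ [p /dS pi [q /dT qj <-]]; exact: leq_add.
- move=> N [u [v [g /cS[p Sp pu] /cT[q Tq qv]]]].
  exists (tensor_pair p q); first by exists p => //; exists q.
  exact: represents_tensor g pu qv.
Qed.

Lemma coverable_sum (k B : nat) (P : nat -> Prop) : coverable k P ->
  coverable k.+1 (fun N => exists a b, [/\ (0 < b <= B)%N, P a, N = (a + b)%N &
    complexity N = (complexity a + complexity b)%N]).
Proof.
move=> [S [fS dS cS]].
exists [set add_pair p c | p in S & c in `I_B]%classic; split.
- exact: finite_image2 fS (finite_II B).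
- by move=> _ [p /dS pi [c _ <-]] /=; rewrite addn1.
- move=> N [a [[|c] [/andP[// _ cB] /cS[p Sp pa] eN cN]]].
  exists (add_pair p c); first by exists p => //; exists c.
  exact: represents_add eN cN pa.
Qed.

Lemma coverable_defect (R : realType) (alpha : R) (k : nat) :
  0 < alpha -> alpha < 1 ->
  coverable k (fun N => (0 < N)%N /\ defect R N < k.+1%:R * alpha).
Proof.
move=> a0 a1; elim/ltn_ind: k => k IH.
have [M hM] := defect_lt1_bounded a1.
(* Factors of defect below $\alpha$ cost no variable. *)
have c0 : coverable 0 (fun N => (0 < N)%N /\ defect R N < alpha).
  by apply: coverable_sub (coverable_bounded 0 M) => // N [N0 /(hM _ N0)].
case: k IH => [|k] IH; first by apply: coverable_sub c0 => // N; rewrite mul1r.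
have [A hA] := mult_irreducible_bounded_or_sum a1.
(* Bounds the smaller summand: $b\le b^3\le 3^{\|b\|}$ and $\|b\|\le\delta(N)+2$. *)
pose B := (3 ^ Num.bound (k.+2%:R * alpha + 2))%N.
(* [A.+1] rather than [A], so that 1 is included even if [A] is 0. *)
have cU := coverableU (coverable_bounded k.+1 A.+1)
  (coverable_sum B (IH k (ltnSn k))).
set U := fun N : nat => _ \/ _ in cU.
have irrU N : (0 < N)%N -> mult_irreducible N ->
    defect R N < k.+2%:R * alpha -> U N.
  have small n : (0 < n <= A.+1)%N -> U n.
    by move=> nA; left; exists 0%N, n; rewrite mul1n addn0.
  case: N => [//|[|N]] _ irr dN; first exact: small.
  have [NA|[a [b [/andP[b0 ba] eN cN da cb]]]] := hA N.+2 isT irr.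
    by apply: small; rewrite (leq_trans NA).
  right; exists a, b; split=> //.
    rewrite b0 (leq_trans (_ : b <= b ^ 3)%N) //; first by rewrite !expnS expn0; nia.
    apply: (leq_trans (cube_le_exp3_complexity b)); rewrite leq_exp2l // -(ler_nat R).
    have p0 : 0 <= k.+2%:R * alpha + 2 by rewrite addr_ge0 // mulr_ge0 // ltW.
    have := archi_boundP p0; lra.
  split; first exact: leq_trans ba.
  by move: dN; rewrite -(natr1 k.+1); lra.
(* Here [i.+1] is the integer part of $\delta(u)/\alpha$. The degrees $i+1$ and $k-i$ add up to
   $k+1$, and both are at most $k$, so the induction hypothesis applies. *)
have c1 : coverable k.+1 (fun N => exists2 i, (i < k)%N &
    exists u v, [/\ good_product N u v,
      (0 < u)%N /\ defect R u < i.+2%:R * alpha &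
      (0 < v)%N /\ defect R v < (k - i).+1%:R * alpha]).
  apply: coverable_bigU => i ik.
  have -> : k.+1 = (i.+1 + (k - i))%N by lia.
  by apply: coverable_product; apply: IH; lia.
have c3 := coverable_product c0 cU.
have c4 := coverable_product c0 (coverable_product c0 c0).
have c4' := coverable_sub (leq0n k.+1) (fun _ h => h) c4.
apply: (coverable_sub (leqnn _) _ (coverableU (coverableU c1 cU) (coverableU c3 c4'))).
move=> N [N0 dN].
have pos u v : good_product N u v -> [/\ (0 < u)%N, (0 < v)%N,
    0 <= defect R u, 0 <= defect R v & defect R N = defect R u + defect R v].
  by move=> g; have [u0 v0 _ _] := g; rewrite !defect_ge0 // (defect_product R g).
have [irr|[u [v [g ua va]]]|[u [v [g ua irr]]]|[u [v [g ua [v1 [v2 [g' v1a v2a]]]]]]] :=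
  defect_product_cases alpha N.
- by left; right; apply: irrU.
- left; left; have [u0 v0 du dv dE] := pos _ _ g.
  have /truncn_itv : 0 <= defect R u / alpha by rewrite divr_ge0 // ltW.
  case: (Num.truncn _) => [|i] /andP[].
    by move=> _; rewrite ltr_pdivrMr // mul1r ltNge ua.
  rewrite ler_pdivlMr // ltr_pdivrMr // => iu ui.
  (* From $\delta(v)\ge\alpha$: $(i+1)\alpha\le\delta(u)<(k+1)\alpha$. *)
  have ik : (i < k)%N.
    have : i.+1%:R * alpha < k.+1%:R * alpha.
      by move: dN; rewrite -(natr1 k.+1); lra.
    by rewrite ltr_pM2r // ltr_nat.
  exists i => //; exists u, v; split=> //; split=> //.
  have -> : (k - i).+1%:R = k.+2%:R - i.+1%:R :> R.
    by rewrite -natrB ?subSS ?subSn //; lia.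
  lra.
- right; left; exists u, v; have [u0 v0 du dv dE] := pos _ _ g.
  by split=> //; apply: irrU => //; lra.
- right; right; exists u, v; have [u0 v0 du dv dE] := pos _ _ g.
  have [v10 v20 _ _] := g'.
  by split=> //; exists v1, v2.
Qed.

Theorem theorem4p10 (R : realType) (r : R) (hr : 0 <= r) :
  exists S : set low_defect_pair,
    finite_set S /\
    (forall p : low_defect_pair, S p ->
       (ldp_degree p)%:Z <= Num.floor r) /\
    (forall N : nat, leaders_below r N ->
       exists p : low_defect_pair, S p /\ efficiently_3_represents p N).
Proof.
pose k := Num.truncn r; have /andP[kr rk] := truncn_itv hr.
(* $r/(k+1)<1$ since $r<k+1$; the maximum with $1/2$ keeps $\alpha$ positive when $r=0$. *)
pose alpha := Num.max (r / k.+1%:R) 2^-1.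
have a0 : 0 < alpha by rewrite lt_max invr_gt0 ltr0n orbT.
have a1 : alpha < 1.
  by rewrite gt_max ltr_pdivrMr ?ltr0n // mul1r rk invf_lt1 ?ltr0n // ltr1n.
have ra : r <= k.+1%:R * alpha.
  by rewrite mulrC -ler_pdivrMr ?ltr0n // le_max lexx.
have [S [fS dS cS]] := coverable_defect k a0 a1.
exists S; split=> //; split=> [p /dS pk|N [[N0 Nmin] Nr]].
  by rewrite floor_ge_int; apply: le_trans kr; rewrite ler_nat.
have [p Sp [l [M [M0 eN cN pM]]]] := cS N (conj N0 (lt_le_trans Nr ra)).
exists p; split=> //; suff -> : N = M by [].
(* [M] has the same defect as the leader [N], so $3^lM=N\le M$. *)
have NM : (N <= M)%N by apply: Nmin => //; rewrite -(defect_mul_exp3 R M0 eN cN).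
by apply/eqP; rewrite eqn_leq NM eN leq_pmull // expn_gt0.
Qed.
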